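(* Let $R$ be a semi-potent ring with Jacobson radical $J(R)$. Then the following are equivalent: (1) The factor ring $R/J(R)$ is a 2-UQ ring. (2) The factor ring $R/J(R)$ is a tripotent ring. (3) The factor ring $R/J(R)$ is a 2-UU ring. (4) The ring $R$ is a 2-UJ ring.
   Context: Rings are associative with unity, not necessarily commutative. $U(R)$ is the set of units, $Nil(R)$ the set of nilpotent elements and $J(R)$ the Jacobson radical of $R$. An element $a\in R$ is quasi-nilpotent if $1-ax$ is invertible for every $x\in R$ with $ax=xa$; $QN(R)$ is the set of quasi-nilpotent elements. $R$ is 2-UQ if the square of each unit is the sum of an idempotent and a quasi-nilpotent element that commute with each other; equivalently, for each $u\in U(R)$, $u^2=1+q$ with $q\in QN(R)$. $R$ is 2-UJ if $u^2\in 1+J(R)$ for every $u\in U(R)$. $R$ is 2-UU if $u^2\in 1+Nil(R)$ for every $u\in U(R)$. $R$ is tripotent if $a^3=a$ for all $a\in R$. $R$ is semi-potent if every one-sided ideal not contained in $J(R)$ contains a non-zero idempotent. *)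

(* Defs.v *)
From HB Require Import structures.
From mathcomp Require Import all_boot all_algebra.
From mathcomp Require Import boolp classical_sets.

Set Implicit Arguments.
Unset Strict Implicit.
Unset Printing Implicit Defensive.

Import GRing.Theory.
Local Open Scope ring_scope.
Local Open Scope classical_set_scope.
Local Open Scope quotient_scope.

Section Ideals.
Variable R : pzRingType.
Implicit Types (I M : set R).

Definition left_ideal I : Prop :=
  [/\ I 0, forall x y, I x -> I y -> I (x - y) & forall a x, I x -> I (a * x)].

Definition right_ideal I : Prop :=
  [/\ I 0, forall x y, I x -> I y -> I (x - y) & forall x a, I x -> I (x * a)].

Definition maximal_left_ideal M : Prop :=
  [/\ left_ideal M, M <> setT &
      forall I, left_ideal I -> M `<=` I -> I <> setT -> I = M].

(* If R is the zero ring there is no maximal left ideal, and J(R) = R. *)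
Definition jacobson : set R := \bigcap_(M in maximal_left_ideal) M.

Lemma left_ideal1 I : left_ideal I -> I 1 -> I = setT.
Proof.
case=> _ _ IM I1; apply/seteqP; split=> // x _.
by rewrite -[x]mulr1; exact: IM.
Qed.

(* The left ideal (M : r) = {x | x r \in M} is again maximal if r \notin M;
   this is what makes jacobson two-sided. *)
Lemma maximal_left_ideal_colon M r : maximal_left_ideal M -> ~ M r ->
  maximal_left_ideal [set x | M (x * r)].
Proof.
move=> [[M0 MB MM] MT Mmax] Mr; split.
- split=> /= [|x y Mx My|a x Mx].
  + by rewrite mul0r.
  + by rewrite mulrBl; exact: MB.
  + by rewrite -mulrA; exact: MM.
- by move/seteqP => [_ /(_ 1 Logic.I)] /=; rewrite mul1r.
move=> I [I0 IB IM] sMI IT; apply/seteqP; split=> // x Ix /=.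
apply: contrapT => Mxr.
have MD y z : M y -> M z -> M (y + z).
  by move=> My Mz; rewrite -[z]opprK; apply: (MB _ _ My); rewrite -sub0r; exact: MB.
pose K : set R := [set z | exists a m, M m /\ z = a * (x * r) + m].
have KI : left_ideal K.
  split=> [|_ _ [a [m [Mm ->]]] [b [n [Mn ->]]]|c _ [a [m [Mm ->]]]].
  - by exists 0, 0; rewrite mul0r addr0.
  - exists (a - b), (m - n); split; first exact: MB.
    by rewrite mulrBl opprD addrACA.
  - exists (c * a), (c * m); split; first exact: MM.
    by rewrite mulrDr mulrA.
have sMK : M `<=` K by move=> z Mz; exists 0, z; rewrite mul0r add0r.
have Kxr : K (x * r) by exists 1, 0; rewrite mul1r addr0.
have [KT|KT] := pselect (K = setT); last by apply: Mxr; rewrite -(Mmax K).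
have : K r by rewrite KT.
move=> [a [m [Mm rE]]].
apply: IT; apply: left_ideal1 => //.
rewrite -(subrK (a * x) 1) -[a * x]opprK; apply: (IB _ _ _ _).
  apply: sMI => /=; rewrite opprK mulrBl mul1r -mulrA {1}rE.
  by rewrite addrAC subrr add0r.
by rewrite -sub0r; apply: IB => //; exact: IM.
Qed.

Lemma jacobson0 : jacobson 0.
Proof. by move=> M [[]]. Qed.

Lemma jacobsonB x y : jacobson x -> jacobson y -> jacobson (x - y).
Proof.
by move=> Jx Jy M mM; have [[_ MB _] _ _] := mM; apply: MB; [exact: Jx|exact: Jy].
Qed.

Lemma jacobsonMl a x : jacobson x -> jacobson (a * x).
Proof. by move=> Jx M mM; have [[_ _ MM] _ _] := mM; apply: MM; exact: Jx. Qed.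

Lemma jacobsonMr x a : jacobson x -> jacobson (x * a).
Proof.
move=> Jx M mM; have [[_ _ MM] _ _] := mM.
have [Ma|Ma] := pselect (M a); first exact: MM.
exact: (Jx _ (maximal_left_ideal_colon mM Ma)).
Qed.

End Ideals.

Section FactorRing.
Variable R : pzRingType.

Definition jacobson_pred : {pred R} := fun x => `[< jacobson x >].

Lemma jacobson_predP x : reflect (jacobson x) (x \in jacobson_pred).
Proof. exact: asboolP. Qed.

Lemma jacobson_zmod_closed : zmod_closed jacobson_pred.
Proof.
split; first by apply/jacobson_predP; exact: jacobson0.
move=> x y /jacobson_predP Jx /jacobson_predP Jy.
by apply/jacobson_predP; exact: jacobsonB.
Qed.

HB.instance Definition _ :=
  GRing.isZmodClosed.Build R jacobson_pred jacobson_zmod_closed.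

(* The library only puts a ring structure on {quot I} for commutative R. *)
Definition factor_jacobson : Type := Quotient.quot jacobson_pred.

HB.instance Definition _ :
  ZmodQuotient R (Quotient.equiv jacobson_pred) 0 -%R +%R factor_jacobson :=
  ZmodQuotient.on factor_jacobson.

Definition factor_one : factor_jacobson := lift_cst factor_jacobson 1.
Definition factor_mul := lift_op2 factor_jacobson *%R.

Lemma pi_eqP (x y : R) :
  \pi_factor_jacobson x = \pi_factor_jacobson y <-> jacobson (x - y).
Proof.
split=> [/eqP|Jxy]; first by rewrite -Quotient.idealrBE => /jacobson_predP.
by apply/eqP; rewrite -Quotient.idealrBE; exact/jacobson_predP.
Qed.

Lemma factor_pi_mul (x y : R) :
  \pi_factor_jacobson (x * y) =
  factor_mul (\pi_factor_jacobson x) (\pi_factor_jacobson y).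
Proof.
rewrite /factor_mul; unlock; apply/pi_eqP.
have JE z : jacobson (z - repr (\pi_factor_jacobson z)).
  by apply/pi_eqP; rewrite reprK.
set x' := repr _; set y' := repr _.
have -> : x * y - x' * y' = (x - x') * y - x' * (y' - y).
  by rewrite mulrBl mulrBr opprB addrA subrK.
apply: jacobsonB; first by apply: jacobsonMr; exact: JE.
by apply: jacobsonMl; apply/pi_eqP; rewrite reprK.
Qed.

Lemma factor_pi_one : \pi_factor_jacobson 1 = factor_one.
Proof. by rewrite /factor_one; unlock. Qed.

Lemma factor_mulA : associative factor_mul.
Proof.
move=> x y z; rewrite -[x]reprK -[y]reprK -[z]reprK.
by rewrite -!factor_pi_mul mulrA.
Qed.

Lemma factor_mul1l : left_id factor_one factor_mul.
Proof. by move=> x; rewrite -[x]reprK -factor_pi_one -factor_pi_mul mul1r. Qed.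

Lemma factor_mul1r : right_id factor_one factor_mul.
Proof. by move=> x; rewrite -[x]reprK -factor_pi_one -factor_pi_mul mulr1. Qed.

Lemma factor_mulDl : left_distributive factor_mul +%R.
Proof.
move=> x y z; rewrite -[x]reprK -[y]reprK -[z]reprK.
by rewrite -pi_addr -!factor_pi_mul mulrDl pi_addr.
Qed.

Lemma factor_mulDr : right_distributive factor_mul +%R.
Proof.
move=> x y z; rewrite -[x]reprK -[y]reprK -[z]reprK.
by rewrite -pi_addr -!factor_pi_mul mulrDr pi_addr.
Qed.

HB.instance Definition _ := GRing.Zmodule_isPzRing.Build factor_jacobson
  factor_mulA factor_mul1l factor_mul1r factor_mulDl factor_mulDr.

Definition pi_jacobson (x : R) : factor_jacobson := \pi_factor_jacobson x.

Lemma pi_jacobson_zmod_morphism : zmod_morphism pi_jacobson.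
Proof. by move=> x y; rewrite /pi_jacobson raddfB. Qed.

Lemma pi_jacobson_monoid_morphism : monoid_morphism pi_jacobson.
Proof. by split=> [|x y]; [exact: factor_pi_one | exact: factor_pi_mul]. Qed.

HB.instance Definition _ := GRing.isZmodMorphism.Build R factor_jacobson
  pi_jacobson pi_jacobson_zmod_morphism.
HB.instance Definition _ := GRing.isMonoidMorphism.Build R factor_jacobson
  pi_jacobson pi_jacobson_monoid_morphism.

Lemma pi_jacobson_eq0 x : pi_jacobson x = 0 <-> jacobson x.
Proof. by rewrite -[0](raddf0 pi_jacobson) -{2}[x]subr0; exact: pi_eqP. Qed.

Lemma pi_jacobson_surj y : exists x, pi_jacobson x = y.
Proof. by exists (repr y); exact: reprK. Qed.

End FactorRing.

Section RingClasses.
Variable R : pzRingType.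
Implicit Types a u e q x : R.

Definition is_unit u : Prop := exists v, u * v = 1 /\ v * u = 1.

Definition is_idempotent e : Prop := e * e = e.

Definition is_nilpotent a : Prop := exists n : nat, a ^+ n = 0.

Definition quasi_nilpotent a : Prop :=
  forall x, a * x = x * a -> is_unit (1 - a * x).

Definition two_UQ : Prop := forall u, is_unit u ->
  exists e q, [/\ is_idempotent e, quasi_nilpotent q, e * q = q * e &
                  u ^+ 2 = e + q].

Definition two_UJ : Prop := forall u, is_unit u ->
  exists2 j, jacobson j & u ^+ 2 = 1 + j.

Definition two_UU : Prop := forall u, is_unit u ->
  exists2 b, is_nilpotent b & u ^+ 2 = 1 + b.

Definition tripotent_ring : Prop := forall a, a ^+ 3 = a.

Definition semi_potent : Prop := forall I : set R,
  left_ideal I \/ right_ideal I -> ~ I `<=` @jacobson R ->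
  exists e, [/\ I e, is_idempotent e & e <> 0].

End RingClasses.

Arguments jacobson : clear implicits.
Arguments factor_jacobson : clear implicits.
Arguments two_UQ : clear implicits.
Arguments two_UJ : clear implicits.
Arguments two_UU : clear implicits.
Arguments tripotent_ring : clear implicits.
Arguments semi_potent : clear implicits.

(* Main.v *)
Require Import Defs.
From mathcomp Require Import all_boot all_algebra.
From mathcomp Require Import boolp classical_sets.

Set Implicit Arguments.
Unset Strict Implicit.
Unset Printing Implicit Defensive.

Import GRing.Theory.
Local Open Scope ring_scope.
Local Open Scope classical_set_scope.

(** Semi-potency passes to [S = R/J(R)] in the strong form: every non-zero
    principal right ideal of [S] contains a non-zero idempotent.  If [S] is 2-UQ
    then no non-zero corner [eSe] has a unit [x] with [x^2 - e] again a unit of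
    [eSe].  A non-zero square-zero element would yield 2x2 matrix units, and
    [[[1,1],[1,0]]] is such an [x]; so [S] is reduced and its idempotents are
    central.  If now [a - a^3 <> 0], a non-zero idempotent [e = (a - a^3)b] makes
    both [ea] and [e(1 - a^2)] units of [eS], so [x = ea] is excluded as well,
    and [S] is tripotent.  The remaining implications only use that nilpotents
    are quasi-nilpotent and that units lift modulo [J(R)]. *)

(** * Units and idempotents modulo the Jacobson radical *)

Section JacobsonUnits.
Variable R : pzRingType.
Implicit Types (I M : set R) (x y u v : R).

Lemma left_idealD I x y : left_ideal I -> I x -> I y -> I (x + y).
Proof.
move=> [I0 IB _] Ix Iy; rewrite -[y]opprK; apply: (IB _ _ Ix).
by rewrite -sub0r; exact: IB.
Qed.

Lemma maximal_left_ideal_exists I : left_ideal I -> ~ I 1 ->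
  exists2 M, maximal_left_ideal M & I `<=` M.
Proof.
move=> IL I1.
(* Taking unions with [I] makes the empty chain harmless. *)
pose P : set (set R) := [set A | left_ideal (A `|` I) /\ ~ (A `|` I) 1].
have [F FP Ftot|A [[AL A1] Amax]] := @Zorn_bigcup R P.
  have [I0 IB IM] := IL; split; last first.
    by move=> [[X FX X1]|//]; have [_] := FP _ FX; apply; left.
  split; first by right.
  - move=> x y [[X FX Xx]|Ix] [[Y FY Yy]|Iy].
    + wlog XY : X Y FX FY Xx Yy / exists2 Z, F Z & Z x /\ Z y.
        apply; [exact: FX|exact: FY|exact: Xx|exact: Yy|].
        by case: (Ftot _ _ FX FY) => s; [exists Y|exists X] => //; split=> //;
          exact: s.
      have [Z FZ [Zx Zy]] := XY.
      have [[_ ZB _] _] := FP _ FZ.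
      by case: (ZB x y (or_introl Zx) (or_introl Zy)); [left; exists Z|right].
    + have [[_ ZB _] _] := FP _ FX.
      by case: (ZB x y (or_introl Xx) (or_intror Iy)); [left; exists X|right].
    + have [[_ ZB _] _] := FP _ FY.
      by case: (ZB x y (or_intror Ix) (or_introl Yy)); [left; exists Y|right].
    + by right; exact: IB.
  - move=> a x [[X FX Xx]|Ix]; last by right; exact: IM.
    have [[_ _ ZM] _] := FP _ FX.
    by case: (ZM a x (or_introl Xx)); [left; exists X|right].
exists (A `|` I); last by move=> x; right.
split=> //; first by move=> AT; apply: A1; rewrite AT.
move=> K KL sAK KT; apply: contrapT => KA.
have KI : K `|` I = K by apply/setUidPl => x Ix; apply: sAK; right.
apply: (Amax K).
  split; first by move=> x Ax; apply: sAK; left.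
  by move=> sKA; apply: KA; apply/seteqP; split=> // x /sKA; left.
split; rewrite KI // => K1.
by apply: KT; exact: left_ideal1.
Qed.

(** If the left ideal generated by [1 - x] were proper, a maximal left ideal above it would contain
    [x] as well, hence 1. *)
Lemma jacobson_left_inverse x : jacobson R x -> exists y, y * (1 - x) = 1.
Proof.
move=> Jx; pose I : set R := [set z | exists y, z = y * (1 - x)].
have IL : left_ideal I.
  split=> [|_ _ [y ->] [z ->]|a _ [y ->]].
  - by exists 0; rewrite mul0r.
  - by exists (y - z); rewrite mulrBl.
  - by exists (a * y); rewrite mulrA.
have [[y yE]|I1] := pselect (I 1); first by exists y.
have [M mM sIM] := maximal_left_ideal_exists IL I1.
have [ML MT _] := mM; case: MT; apply: left_ideal1 => //.
rewrite -(subrK x 1); apply: left_idealD => //; last exact: Jx.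
by apply: sIM; exists 1; rewrite mul1r.
Qed.

Lemma jacobson_unit x : jacobson R x -> is_unit (1 - x).
Proof.
move=> Jx; have [y yE] := jacobson_left_inverse Jx.
(* [y = 1 + y * x] is again 1 minus a radical element, so [y] has a left inverse [z] besides its
   right inverse [1 - x]. *)
have Jyx : jacobson R (- (y * x)).
  by rewrite -sub0r; apply: jacobsonB; [exact: jacobson0|exact: jacobsonMl].
have [z] := jacobson_left_inverse Jyx.
have -> : 1 - - (y * x) = y by rewrite opprK -{1}yE mulrBr mulr1 subrK.
move=> zE; exists y; split=> //.
suff -> : 1 - x = z by [].
by rewrite -[LHS]mul1r -{1}zE -mulrA yE mulr1.
Qed.

Lemma jacobson_idempotent e : jacobson R e -> is_idempotent e -> e = 0.
Proof.
move=> /jacobson_left_inverse[y yE] ee.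
by rewrite -[e]mul1r -yE -mulrA mulrBl mul1r ee subrr mulr0.
Qed.

Lemma is_unit_factor u v w : is_unit (u * v) -> is_unit (w * u) -> is_unit u.
Proof.
move=> [s [us _]] [t [_ tw]].
have rE : u * (v * s) = 1 by rewrite mulrA.
have lE : (t * w) * u = 1 by rewrite -mulrA.
exists (v * s); split=> //.
by rewrite -[v * s]mul1r -lE -(mulrA _ u) rE mulr1.
Qed.

Lemma unit_lift_jacobson u : is_unit (pi_jacobson u) -> is_unit u.
Proof.
move=> [y [uy yu]]; have [v vE] := pi_jacobson_surj y.
have J1 (t : R) : pi_jacobson t = 1 -> is_unit t.
  move=> t1; have -> : t = 1 - (1 - t) by rewrite subKr.
  apply: jacobson_unit.
  by apply/pi_jacobson_eq0; rewrite rmorphB rmorph1 /= t1 subrr.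
by apply: (@is_unit_factor u v v); apply: J1; rewrite rmorphM /= vE.
Qed.

(** For a lift [r] of [a], the right ideal [r R] is not inside the radical; the idempotent it
    contains survives in the factor ring because the radical has no non-zero idempotent. *)
Lemma semi_potent_factor (a : factor_jacobson R) : semi_potent R -> a <> 0 ->
  exists b, is_idempotent (a * b) /\ a * b <> 0.
Proof.
move=> hR; have [r <-] := pi_jacobson_surj a => r0.
pose I : set R := [set x | exists b, x = r * b].
have IR : right_ideal I.
  split=> [|_ _ [y ->] [z ->]|_ c [y ->]].
  - by exists 0; rewrite mulr0.
  - by exists (y - z); rewrite mulrBr.
  - by exists (y * c); rewrite mulrA.
have [|e [[b ->] ee e0]] := hR I (or_intror IR).
  by move=> sIJ; apply: r0; apply/pi_jacobson_eq0; apply: sIJ; exists 1; rewrite mulr1.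
exists (pi_jacobson b); rewrite /is_idempotent -!rmorphM ee; split=> //.
by move=> /pi_jacobson_eq0 J; apply: e0; exact: jacobson_idempotent.
Qed.

End JacobsonUnits.

(** * Units of 2-UQ rings and of their corners *)

Section TwoUQ.
Variable S : pzRingType.
Implicit Types a b c e q u x y z : S.

Lemma nilpotent_quasi_nilpotent a : is_nilpotent a -> quasi_nilpotent a.
Proof.
move=> [n an] x ax; have axn : (a * x) ^+ n = 0 by rewrite exprMn_comm // an mul0r.
pose s := \sum_(i < n) (a * x) ^+ i.
have sE : (1 - a * x) * s = 1.
  by rewrite -opprB mulNr -subrX1 axn sub0r opprK.
exists s; split=> //; rewrite -[RHS]sE; apply: commr_sym.
apply: commr_sum => i _; apply: commrX; apply: commr_sym.
by apply: commrB; [exact: commr1|exact: commr_refl].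
Qed.

Lemma unit_idempotent e : is_unit e -> is_idempotent e -> e = 1.
Proof. by move=> [v [ev ve]] ee; rewrite -[e]mul1r -ve -mulrA ee. Qed.

(** On the complement of [e], [q] agrees with the unit [u ^+ 2], so [1 - e] is a multiple of [q] by
    a commuting element. Quasi-nilpotency then makes [e] a unit, hence 1. *)
Lemma two_UQ_quasi_nilpotent u : two_UQ S -> is_unit u ->
  quasi_nilpotent (u ^+ 2 - 1).
Proof.
move=> hQ uU; have [e [q [ee hq eq uE]]] := hQ u uU.
have [v [uv vu]] := uU.
have uuvv : u ^+ 2 * v ^+ 2 = 1.
  by rewrite !expr2 -mulrA (mulrA u v) uv mul1r.
have vvuu : v ^+ 2 * u ^+ 2 = 1.
  by rewrite !expr2 -mulrA (mulrA v u) vu mul1r.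
have cv t : GRing.comm t (u ^+ 2) -> GRing.comm t (v ^+ 2).
  move=> tu; rewrite /GRing.comm -[t * _]mul1r -vvuu -mulrA (mulrA _ t) -tu.
  by rewrite -mulrA uuvv mulr1.
have eU : GRing.comm e (u ^+ 2) by rewrite uE; apply: commrD.
have qU : GRing.comm q (u ^+ 2) by rewrite uE; apply: commrD.
have qf : q * (1 - e) = u ^+ 2 * (1 - e).
  by rewrite uE mulrDl [e * (1 - e)]mulrBr mulr1 ee subrr add0r.
have fv : GRing.comm (1 - e) (v ^+ 2).
  by apply: cv; apply: commr_sym; apply: commrB; [exact: commr1|exact: commr_sym].
have qx : q * ((1 - e) * v ^+ 2) = 1 - e.
  by rewrite mulrA qf -mulrA fv mulrA uuvv mul1r.
have /unit_idempotent e1 : is_unit e.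
  rewrite -[e](subKr 1) -{1}qx; apply: hq.
  apply: commrM; last exact: cv.
  by apply: commrB; [exact: commr1|exact: commr_sym].
by rewrite uE (e1 ee) addrC addKr.
Qed.

(** The corner unit [x] extends to the unit [x + (1 - e)] of [S], whose square minus 1 is
    [x * x - e]. Testing quasi-nilpotency against [z] makes [1 - e] a unit, yet it kills [e]. *)
Lemma two_UQ_corner e x y z : two_UQ S -> is_idempotent e ->
  e * x = x -> x * e = x -> e * y = y -> y * e = y -> x * y = e -> y * x = e ->
  (x * x - e) * z = e -> z * (x * x - e) = e -> e = 0.
Proof.
move=> hQ ee ex xe ey ye xy yx qz zq.
have mulE s t : e * t = t -> s * e = s ->
    (s + (1 - e)) * (t + (1 - e)) = s * t + (1 - e).
  move=> et se; have t0 : (1 - e) * t = 0 by rewrite mulrBl mul1r et subrr.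
  have s0 : s * (1 - e) = 0 by rewrite mulrBr mulr1 se subrr.
  have f2 : (1 - e) * (1 - e) = 1 - e.
    by rewrite mulrBl mul1r mulrBr mulr1 ee subrr subr0.
  by move: (1 - e) t0 s0 f2 => f t0 s0 f2; rewrite mulrDl !mulrDr t0 s0 f2 addr0 add0r.
have uU : is_unit (x + (1 - e)).
  by exists (y + (1 - e)); rewrite !mulE // xy yx addrC subrK.
have qE : (x + (1 - e)) ^+ 2 - 1 = x * x - e.
  by rewrite expr2 mulE // addrCA addrAC subrr add0r.
have := two_UQ_quasi_nilpotent hQ uU; rewrite qE => /(_ z); rewrite qz zq.
case=> // v [_ ve].
by rewrite -[e]mul1r -ve -mulrA mulrBl mul1r ee subrr mulr0.
Qed.

(* [a] and [b] play the roles of the matrix units [e12] and [e21]. *)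
Lemma two_UQ_matrix_units a b : two_UQ S -> a * a = 0 -> b * b = 0 ->
  a * b * a = a -> b * a * b = b -> a = 0.
Proof.
move=> hQ aa bb aba bab.
pose h := a * b + b * a; pose w := a * b + a + b.
have ha : h * a = a by rewrite mulrDl aba -mulrA aa mulr0 addr0.
have hb : h * b = b by rewrite mulrDl bab -mulrA bb mulr0 add0r.
have ah : a * h = a by rewrite mulrDr !mulrA aba aa mul0r add0r.
have bh : b * h = b by rewrite mulrDr !mulrA bab bb mul0r addr0.
have hh : h * h = h by rewrite {2}/h mulrDr !mulrA ha hb.
have hw : h * w = w by rewrite !mulrDr mulrA ha hb.
have wh : w * h = w by rewrite !mulrDl -mulrA ah bh.
(* Cayley-Hamilton for a matrix of trace 1 and determinant -1: [w - h] inverts [w], which is also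
   [w * w - h]. *)
have ww : w * w = w + h.
  rewrite {2}/w !mulrDr mulrA.
  have -> : w * a = a + b * a by rewrite !mulrDl aba aa addr0.
  have -> : w * b = a * b by rewrite !mulrDl -mulrA bb mulr0 add0r addr0.
  rewrite mulrDl bab /w /h -!addrA; congr (_ + _).
  by rewrite addrCA (addrC (b * a)).
have wwh : w * (w - h) = h by rewrite mulrBr ww wh addrAC subrr add0r.
have whw : (w - h) * w = h by rewrite mulrBl ww hw addrAC subrr add0r.
have h0 : h = 0.
  apply: (@two_UQ_corner h w (w - h) (w - h)) => //; rewrite ?ww ?addrK //.
    by rewrite mulrBr hw hh.
  by rewrite mulrBl wh hh.
by rewrite -ha h0 mul0r.
Qed.

(** * Reducedness, central idempotents and tripotency *)

Hypothesis idem : forall a, a <> 0 ->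
  exists b, is_idempotent (a * b) /\ a * b <> 0.
Hypothesis hQ : two_UQ S.

Lemma two_UQ_reduced a : a * a = 0 -> a = 0.
Proof.
move=> aa; apply: contrapT => /idem[b0 []]; set e := a * b0 => ee e0.
pose b := b0 * e; apply: e0.
have ab : a * b = e by rewrite mulrA ee.
have be : b * e = b by rewrite -mulrA ee.
have ae : a * e = 0 by rewrite mulrA aa mul0r.
(* The matrix units are [e * a] and [(1 - e) * b]: they square to zero since [a * e = 0] and
   [b * e = b], and their product is still [e]. *)
have ab' : e * a * ((1 - e) * b) = e.
  by rewrite mulrA -(mulrA e) mulrBr mulr1 ae subr0 -mulrA ab.
have ea0 : e * a = 0.
  apply: (@two_UQ_matrix_units _ ((1 - e) * b)) => //.
  - by rewrite mulrA -(mulrA e) ae mulr0 mul0r.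
  - by rewrite mulrA -(mulrA _ b) mulrBr mulr1 be subrr mulr0 mul0r.
  - by rewrite ab' mulrA ee.
  - by rewrite -mulrA ab' -mulrA be.
by rewrite -ab' ea0 mul0r.
Qed.

(** Both off-diagonal Peirce components of [x] square to zero. *)
Lemma two_UQ_idempotent_central e x : is_idempotent e -> e * x = x * e.
Proof.
move=> ee.
have l : (1 - e) * e = 0 by rewrite mulrBl mul1r ee subrr.
have r : e * (1 - e) = 0 by rewrite mulrBr mulr1 ee subrr.
have : e * x * (1 - e) = 0.
  by apply: two_UQ_reduced;
    rewrite !mulrA -(mulrA _ (1 - e) e) l mulr0 !mul0r.
have : (1 - e) * x * e = 0.
  by apply: two_UQ_reduced; rewrite !mulrA -(mulrA _ e (1 - e)) r mulr0 !mul0r.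
rewrite mulrBl mulrBl mul1r => /subr0_eq ->.
by rewrite mulrBr mulr1 => /subr0_eq.
Qed.

(** [y * x] is idempotent, hence central, and can move past [x] in [y * x * (x * y)]. *)
Lemma two_UQ_inverse_sym e x y : is_idempotent e -> y * e = y -> x * y = e ->
  y * x = e.
Proof.
move=> ee ye xy.
have yx : is_idempotent (y * x).
  by rewrite /is_idempotent mulrA -(mulrA y) xy ye.
have yxe : y * x * e = y * x.
  by rewrite -mulrA -(two_UQ_idempotent_central x ee) mulrA ye.
rewrite -yxe -xy mulrA (two_UQ_idempotent_central x yx).
by rewrite -!mulrA xy ye xy.
Qed.

Lemma two_UQ_tripotent : tripotent_ring S.
Proof.
move=> a; apply: contrapT => a3.
have /idem[b []] : a - a ^+ 3 <> 0 by move/subr0_eq/esym.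
set e := _ * b => ee e0; apply: e0.
pose d := 1 - a * a.
have ad : a - a ^+ 3 = a * d by rewrite /d mulrBr mulr1 !exprS expr0 mulr1.
have da : a - a ^+ 3 = d * a.
  by rewrite /d mulrBl mul1r !exprS expr0 mulr1 mulrA.
have eC x : e * x = x * e := two_UQ_idempotent_central x ee.
(* [a] and [d] commute, so each is a left factor of [a - a ^+ 3]; the remaining factors give its
   right inverse relative to [e]. *)
pose y := d * b * e; pose z := a * b * e.
have ye : y * e = y by rewrite -mulrA ee.
have ze : z * e = z by rewrite -mulrA ee.
have ay : a * y = e by rewrite /y 2!(mulrA a) -ad ee.
have dz : d * z = e by rewrite /z 2!(mulrA d) -da ee.
have ya := two_UQ_inverse_sym ee ye ay.
have zd := two_UQ_inverse_sym ee ze dz.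
have qE : a * e * (a * e) - e = - (d * e).
  by rewrite mulrA -(mulrA a) eC mulrA -mulrA ee /d mulrBl mul1r opprB.
apply: (@two_UQ_corner e (a * e) y (- z)) => //.
- by rewrite eC -mulrA ee.
- by rewrite -mulrA ee.
- by rewrite eC.
- by rewrite -mulrA eC ye.
- by rewrite mulrA ya.
- by rewrite qE mulrNN -mulrA eC ze.
- by rewrite qE mulrNN mulrA zd.
Qed.

End TwoUQ.

Theorem theorem3p3 (R : pzRingType) (hR : semi_potent R) :
  [<-> two_UQ (factor_jacobson R);
       tripotent_ring (factor_jacobson R);
       two_UU (factor_jacobson R);
       two_UJ R].
Proof.
have UQ3 : two_UQ (factor_jacobson R) -> tripotent_ring (factor_jacobson R).
  by move=> hQ; apply: two_UQ_tripotent hQ => a; exact: semi_potent_factor.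
have unit_sqr (S : pzRingType) (u : S) : tripotent_ring S -> is_unit u ->
    u ^+ 2 = 1.
  move=> h3 [v [uv _]].
  by rewrite -[LHS]mulr1 -uv mulrA -exprSr h3.
tfae.
- exact: UQ3.
- move=> h3 u uU; exists 0; first by exists 1%N; rewrite expr1.
  by rewrite addr0; exact: unit_sqr.
(* Going back through 2-UQ to tripotency makes units of the factor ring square to exactly 1, with no
   nilpotent remainder. *)
- move=> hU; have hQ : two_UQ (factor_jacobson R).
    move=> u /hU[b bn ->]; exists 1, b; split=> //.
    + by rewrite /is_idempotent mulr1.
    + exact: nilpotent_quasi_nilpotent.
    + by rewrite mul1r mulr1.
  move=> u [v [uv vu]]; exists (u ^+ 2 - 1); last by rewrite addrC subrK.
  apply/pi_jacobson_eq0; rewrite rmorphB rmorph1 rmorphXn unit_sqr ?subrr //.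
    exact: UQ3.
  by exists (pi_jacobson v); rewrite -!rmorphM uv vu rmorph1.
(* A unit of the factor ring lifts to a unit [r], and [r ^+ 2] reduces to 1, so the decomposition is
   [1 + 0]. *)
- move=> hJ u uU; have [r rE] := pi_jacobson_surj u.
  have [|j Jj r2] := hJ r; first by apply: unit_lift_jacobson; rewrite rE.
  exists 1, 0; split.
  + by rewrite /is_idempotent mulr1.
  + by move=> x _; rewrite mul0r subr0; exists 1; rewrite mulr1.
  + by rewrite mulr0 mul0r.
  rewrite -rE -rmorphXn r2 rmorphD rmorph1; congr (_ + _).
  exact/pi_jacobson_eq0.
Qed.
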